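(* Finite metric spaces $X$ and $Y$ are indistinguishable if and only if $\#X=\#Y$, $\operatorname{diam}X=\operatorname{diam}Y$, and $M_n(X)=M_n(Y)$ for each $n\le\#X=\#Y$.
   Context: All metric spaces are non-empty; $\#X$ is the cardinality of $X$, $|xy|$ is the distance between points, $|AB|=\inf\{|ab|:a\in A,\,b\in B\}$ for non-empty subsets, and $\operatorname{diam}X=\sup\{|xy|:x,y\in X\}$. $d_{GH}$ is the Gromov--Hausdorff distance: the infimum of the $r$ such that $X$ and $Y$ embed isometrically in a common metric space with Hausdorff distance between their images at most $r$. For a cardinal $n\ge1$, $\Delta_n$ is the metric space of cardinality $n$ with all non-zero distances equal to $1$; for $\lambda>0$, $\lambda\Delta_n$ is obtained by multiplying all distances by $\lambda$, and $0\Delta_n:=\Delta_1$ (one point). The spaces $\lambda\Delta_n$ are called simplexes. Metric spaces $X$ and $Y$ are indistinguishable if $d_{GH}(\lambda\Delta_n,X)=d_{GH}(\lambda\Delta_n,Y)$ for every cardinal $n\ge1$ and every real $\lambda\ge0$. For a cardinal $1\le n\le\#X$, $\mathcal D_n(X)$ is the set of all partitions of $X$ into $n$ non-empty subsets. For $D=\{X_i\}_{i\in I}\in\mathcal D_n(X)$ put $\operatorname{diam}D=\sup_{i\in I}\operatorname{diam}X_i$, and $\alpha(D)=\inf\{|X_iX_j|:i\ne j\}$ if $n\ge2$, $\alpha(D)=\infty$ if $n=1$. Let $\alpha_n^+(X)=\sup_{D\in\mathcal D_n(X)}\alpha(D)$. Let $\mathcal{AD}_n(X)$ be the set of all pairs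 $(\alpha(D),\operatorname{diam}D)$, $D\in\mathcal D_n(X)$, regarded as points of the plane $\mathbb R^2(\alpha,d)$ with coordinates $(\alpha,d)$, and let $\overline{\mathcal{AD}}_n(X)$ be its closure (for $n=1$ this set is the single pair $(\infty,\operatorname{diam}X)$, and the value $\alpha=\infty$ is allowed). A point $(\alpha,d)\in\overline{\mathcal{AD}}_n(X)$ is extremal if there is no point $(\alpha',d')\in\overline{\mathcal{AD}}_n(X)$ different from it with $\alpha'\ge\alpha$ and $d'\le d$. The set of extremal points is $\operatorname{Ext}_n(X)$ (it is non-empty), and $\overline{\operatorname{Ext}}_n(X)$ is its closure. Let $\Pi_X^+$ be the half-plane $\alpha+2d\ge\operatorname{diam}X$ and $\Pi_X^-$ the half-plane $\alpha+2d\le\operatorname{diam}X$. The set $M_n(X)$ is defined as follows. (1) If $\operatorname{Ext}_n(X)\subset\Pi_X^+$, then $M_n(X)=\operatorname{Ext}_n(X)$. (2) If $\operatorname{Ext}_n(X)\subset\Pi_X^-$, then $M_n(X)=\{A_+\}$, where $A_+=\bigl(\alpha_n^+(X),\frac{\operatorname{diam}X-\alpha_n^+(X)}{2}\bigr)$. (3) In the remaining case, let $(\alpha_\pm,d_\pm)$ denote the point of $\overline{\operatorname{Ext}}_n(X)\cap\Pi_X^\pm$ closest to the line $\alpha+2d=\operatorname{diam}X$ (both sets are non-empty). If $(\alpha_-,d_+)\in\Pi_X^-$, then $M_n(X)=\overline{\operatorname{Ext}}_n(X)\cap\Pi_X^+$. Otherwise $M_n(X)=\bigl(\overline{\operatorname{Ext}}_n(X)\cap\Pi_X^+\bigr)\cup\{A\}$,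 where $A=\bigl(\alpha_-,\frac{\operatorname{diam}X-\alpha_-}{2}\bigr)$. *)

(* Defs.v *)
From HB Require Import structures.
From mathcomp Require Import all_boot all_order all_algebra.
From mathcomp Require Import all_classical all_reals all_analysis.

Set Implicit Arguments.
Unset Strict Implicit.
Unset Printing Implicit Defensive.

Import Order.TTheory GRing.Theory Num.Theory.
Import numFieldTopology.Exports.

Local Open Scope classical_set_scope.
Local Open Scope ring_scope.

(** * Gromov--Hausdorff distance *)

Section Distances.
Context {R : realType}.

Definition hausdorff_dist {Z : metricType R} (A B : set Z) : \bar R :=
  Order.max
    (ereal_sup [set ereal_inf [set (mdist a b)%:E | b in B] | a in A])
    (ereal_sup [set ereal_inf [set (mdist a b)%:E | a in A] | b in B]).

Definition isometric_embedding {X Z : metricType R} (f : X -> Z) : Prop :=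
  forall x y, mdist (f x) (f y) = mdist x y.

Definition dGH (X Y : metricType R) : \bar R :=
  ereal_inf [set r%:E | r in [set r : R |
    exists (Z : metricType R) (f : X -> Z) (g : Y -> Z),
      [/\ isometric_embedding f, isometric_embedding g &
          (hausdorff_dist (range f) (range g) <= r%:E)%E]]].

(* |AB|; the real [inf] is the infimum whenever A and B are non-empty. *)
Definition set_dist {X : metricType R} (A B : set X) : R :=
  inf [set mdist a b | a in A & b in B].

(* The real [sup] is the supremum whenever A is non-empty and bounded. *)
Definition diam {X : metricType R} (A : set X) : R :=
  sup [set mdist a b | a in A & b in A].

End Distances.

(** * Simplexes and indistinguishability *)

(* A cardinal n >= 1 is represented by a non-empty type I;
   [{classic I}] is I with its classical choice structure. *)
Definition posSimplex (R : realType) (lam : {posnum R}) (I : Type) : Type :=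
  {classic I}.

Section PosSimplex.
Context (R : realType) (lam : {posnum R}) (I : Type).
Local Notation T := (posSimplex lam I).

HB.instance Definition _ := Choice.copy T {classic I}.

Let dist (i j : T) : R := lam%:num * (i != j)%:R.

Let dist_xx i : dist i i = 0.
Proof. by rewrite /dist eqxx mulr0. Qed.

Let dist_pos i j : dist i j = 0 -> i = j.
Proof.
rewrite /dist; have [//|_ /eqP] := eqVneq i j.
by rewrite mulr1 gt_eqF.
Qed.

Let dist_sym i j : dist i j = dist j i.
Proof. by rewrite /dist eq_sym. Qed.

Let dist_triangle j i k : dist i k <= dist i j + dist j k.
Proof.
rewrite /dist -mulrDr ler_pM2l// -natrD ler_nat.
have [->|_] := eqVneq i j; first by rewrite add0n.
by rewrite (leq_trans (leq_b1 _)).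
Qed.

HB.instance Definition _ :=
  isMetric.Build R T dist_xx dist_pos dist_sym dist_triangle.

End PosSimplex.

(* The second branch is 0 Delta_n := Delta_1; only lam >= 0 is meaningful. *)
Definition simplex {R : realType} (lam : R) (I : Type) : metricType R :=
  if pselect (0 < lam) is left lam_gt0
  then posSimplex (PosNum lam_gt0) I
  else posSimplex (1%:pos : {posnum R}) unit.

Definition indistinguishable {R : realType} (X Y : metricType R) : Prop :=
  forall (I : Type) (lam : R), [set: I] !=set0 -> 0 <= lam ->
    dGH (simplex lam I) X = dGH (simplex lam I) Y.

(** * The sets M_n(X) *)

Section Extremal.
Context {R : realType} (X : metricType R) (n : nat).

Definition partitions : set ('I_n -> set X) :=
  [set D | partition [set: 'I_n] D [set: X]].

(* For n = 1 this is the infimum of the empty set, i.e. +oo. *)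
Definition alpha (D : 'I_n -> set X) : \bar R :=
  ereal_inf [set (set_dist (D ij.1) (D ij.2))%:E |
              ij in [set ij : 'I_n * 'I_n | ij.1 != ij.2]].

Definition diam_partition (D : 'I_n -> set X) : R :=
  sup (range (fun i => diam (D i))).

Definition alpha_plus : \bar R := ereal_sup [set alpha D | D in partitions].

Definition AD : set (\bar R * R) :=
  [set (alpha D, diam_partition D) | D in partitions].

(* For bounded X and n >= 2 the values alpha(D) are bounded, so the closure of
   AD in \bar R * R is its closure in the plane; for n = 1 it is a singleton. *)
Definition Ext : set (\bar R * R) :=
  [set p | closure AD p /\
     ~ exists q, [/\ closure AD q, q <> p, (p.1 <= q.1)%E & q.2 <= p.2]].

Definition Pi_plus : set (\bar R * R) :=
  [set p | ((diam [set: X])%:E <= p.1 + (2 * p.2)%:E)%E].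

Definition Pi_minus : set (\bar R * R) :=
  [set p | (p.1 + (2 * p.2)%:E <= (diam [set: X])%:E)%E].

(* Euclidean distance from p to the line alpha + 2 d = diam X, meaningful when
   p.1 is finite. *)
Definition dist_line (p : \bar R * R) : R :=
  inf [set Num.sqrt ((fine p.1 - q.1) ^+ 2 + (p.2 - q.2) ^+ 2) |
        q in [set q : R * R | q.1 + 2 * q.2 = diam [set: X]]].

Definition closest_to_line (S : set (\bar R * R)) : \bar R * R :=
  xget (0%E, 0)
    [set p | S p /\ forall q, S q -> dist_line p <= dist_line q].

Definition on_line (a : \bar R) : \bar R * R :=
  (a, (diam [set: X] - fine a) / 2).

(* In the last two cases alpha is finite: for n = 1 the set Ext is
   {(+oo, diam X)}, which is contained in Pi_plus. *)
Definition M : set (\bar R * R) :=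
  if `[< Ext `<=` Pi_plus >] then Ext
  else if `[< Ext `<=` Pi_minus >] then [set on_line alpha_plus]
  else
    let p_plus := closest_to_line (closure Ext `&` Pi_plus) in
    let p_minus := closest_to_line (closure Ext `&` Pi_minus) in
    if `[< Pi_minus (p_minus.1, p_plus.2) >]
    then closure Ext `&` Pi_plus
    else (closure Ext `&` Pi_plus) `|` [set on_line p_minus.1].

End Extremal.

(* Main.v *)
(* Up to an arbitrarily small error, 2 d_GH(l Delta_I, X) <= v means that some
   correspondence between l Delta_I and X has distortion at most v. For
   #I > #X this amounts to max(l, diam X - l) <= v, and for #I = n <= #X to
   diam X - l <= v together with the existence of a partition D of X into n
   parts with diam D <= v and l - alpha(D) <= v. Under diam X - l <= v, a pair
   (alpha, d) below the line alpha + 2 d = diam X imposes the same condition as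
   its projection (alpha, (diam X - alpha) / 2) to this line, and M_n(X) is the
   set of extremal points of the configuration projected in this way.
   Hence M_n(X) determines the distances to all l Delta_n. Conversely, M_n(X)
   lies in Pi_X^+, so that for (alpha, d) in M_n(X) the conditions at
   l = alpha + d, v = d ask precisely for a pair dominating (alpha, d), and a
   set of pairwise incomparable points is determined by the pairs it
   dominates. *)
Require Import Defs.
From HB Require Import structures.
From mathcomp Require Import all_boot all_order all_algebra.
From mathcomp Require Import all_classical all_reals all_analysis.
From mathcomp Require Import ring lra.

Set Implicit Arguments.
Unset Strict Implicit.
Unset Printing Implicit Defensive.

Import Order.TTheory GRing.Theory Num.Theory.
Import numFieldTopology.Exports.

Local Open Scope classical_set_scope.
Local Open Scope card_scope.
Local Open Scope ring_scope.

(** * Gluing along a correspondence *)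

(** The distortion bound is [2 * r], so that [r] itself bounds the Gromov-Hausdorff distance. *)
Record correspondence (R : realType) (X Y : metricType R) (r : R) :=
  Correspondence {
    corr_rel :> X -> Y -> Prop;
    corr_left : forall x, exists y, corr_rel x y;
    corr_right : forall y, exists x, corr_rel x y;
    corr_dis : forall x x' y y', corr_rel x y -> corr_rel x' y' ->
      `|mdist x x' - mdist y y'| <= 2 * r }.

(* The disjoint union, with corresponding points at distance [r]. *)
Definition glue (R : realType) (X Y : metricType R) (r : {posnum R})
  (C : correspondence X Y r%:num) : Type := (X + Y)%type.

Section Glue.
Context (R : realType) (X Y : metricType R) (r : {posnum R}).
Context (C : correspondence X Y r%:num).
Local Notation T := (glue C).

HB.instance Definition _ := Choice.copy T (X + Y)%type.

(** The gluing carries a shortest-path metric: a path from [x] to [y] crosses one bridge of length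
    [r] between corresponding points. *)
Let lengths x y : set R :=
  [set mdist x p.1 + r%:num + mdist p.2 y | p in [set p | C p.1 p.2]].

Let cross x y : R := inf (lengths x y).

Let cross_le x y x' y' : C x' y' ->
  cross x y <= mdist x x' + r%:num + mdist y' y.
Proof.
move=> Cxy; apply: ge_inf; last by exists (x', y').
exists 0 => _ [p _ <-].
by rewrite !addr_ge0 ?mdist_ge0.
Qed.

Let cross_ge x y c :
  (forall x' y', C x' y' -> c <= mdist x x' + r%:num + mdist y' y) ->
  c <= cross x y.
Proof.
move=> h; apply: lb_le_inf.
  by have [y' Cxy'] := corr_left C x; eexists; exists (x, y').
by move=> _ [p Cp <-]; exact: h.
Qed.

Let dist (u v : T) : R :=
  match u, v with
  | inl x, inl x' => mdist x x'
  | inr y, inr y' => mdist y y'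
  | inl x, inr y => cross x y
  | inr y, inl x => cross x y
  end.

Let cross_gt0 x y : 0 < cross x y.
Proof.
apply: (@lt_le_trans _ _ r%:num) => //.
apply: cross_ge => x' y' _.
by have := mdist_ge0 x x'; have := mdist_ge0 y' y; lra.
Qed.

Let dist_xx u : dist u u = 0.
Proof. by case: u => z /=; rewrite mdistxx. Qed.

Let dist_pos u v : dist u v = 0 -> u = v.
Proof.
case: u v => [x|y] [x'|y'] /=.
- by move=> /mdist_positivity ->.
- by have := cross_gt0 x y' => /[swap] ->; rewrite ltxx.
- by have := cross_gt0 x' y => /[swap] ->; rewrite ltxx.
- by move=> /mdist_positivity ->.
Qed.

Let dist_sym u v : dist u v = dist v u.
Proof. by case: u v => [x|y] [x'|y'] //=; rewrite metric_sym. Qed.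

Let cross_triangle_l x x' y : cross x y <= mdist x x' + cross x' y.
Proof.
rewrite -lerBlDl; apply: cross_ge => a b Cab.
have := cross_le x y Cab; have := metric_triangle x x' a; lra.
Qed.

Let cross_triangle_r x y y' : cross x y <= cross x y' + mdist y' y.
Proof.
rewrite -lerBlDr; apply: cross_ge => a b Cab.
have := cross_le x y Cab; have := metric_triangle b y' y; lra.
Qed.

(** A path that leaves one space and returns crosses two bridges; their total length [2 * r] absorbs
    the distortion, so the detour is no shortcut. *)
Let le_crossD_l x x' y : mdist x x' <= cross x y + cross x' y.
Proof.
rewrite -lerBlDr; apply: cross_ge => a b Cab.
rewrite lerBlDl -lerBlDr; apply: cross_ge => a' b' Cab'.
have := corr_dis Cab Cab'.
have := metric_triangle b y b'; rewrite (metric_sym y b').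
have := metric_triangle x a x'; have := metric_triangle a a' x'.
rewrite (metric_sym a' x').
by rewrite ler_norml => ? ? ? /andP[? ?]; lra.
Qed.

Let le_crossD_r x y y' : mdist y y' <= cross x y + cross x y'.
Proof.
rewrite -lerBlDr; apply: cross_ge => a b Cab.
rewrite lerBlDl -lerBlDr; apply: cross_ge => a' b' Cab'.
have := corr_dis Cab Cab'.
have := metric_triangle a x a'; rewrite (metric_sym a x).
have := metric_triangle y b y'; have := metric_triangle b b' y'.
rewrite (metric_sym y b).
by rewrite ler_norml => ? ? ? /andP[? ?]; lra.
Qed.

Let dist_triangle v u w : dist u w <= dist u v + dist v w.
Proof.
case: u v w => [x|y] [x'|y'] [x''|y''] /=.
- exact: metric_triangle.
- exact: cross_triangle_l.
- exact: le_crossD_l.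
- exact: cross_triangle_r.
- by rewrite addrC metric_sym; exact: cross_triangle_l.
- exact: le_crossD_r.
- by rewrite addrC metric_sym; exact: cross_triangle_r.
- exact: metric_triangle.
Qed.

HB.instance Definition _ :=
  isMetric.Build R T dist_xx dist_pos dist_sym dist_triangle.

Lemma glue_cross_le x y : C x y ->
  mdist (inl x : T) (inr y : T) <= r%:num.
Proof.
by move=> Cxy; have := cross_le x y Cxy; rewrite !mdistxx addr0 add0r.
Qed.

Lemma glue_inl : isometric_embedding (inl : X -> T).
Proof. by []. Qed.

Lemma glue_inr : isometric_embedding (inr : Y -> T).
Proof. by []. Qed.

End Glue.

(** * Gromov-Hausdorff distance through correspondences *)

Section GromovHausdorff.
Context (R : realType) (X Y : metricType R).

Lemma correspondence_dGH_le (r : R) :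
  correspondence X Y r -> 0 < r -> (dGH X Y <= r%:E)%E.
Proof.
move=> C0 r0; pose r' := PosNum r0; pose C : correspondence X Y r'%:num := C0.
apply: ereal_inf_lbound; exists r => //.
exists (glue C : metricType R), inl, inr.
split; [exact: glue_inl|exact: glue_inr|].
rewrite /hausdorff_dist ge_max; apply/andP; split.
- apply: ge_ereal_sup => _ [_ [x _ <-] <-].
  have [y Cxy] := corr_left C x.
  apply: (@le_trans _ _ (mdist (inl x : glue C) (inr y : glue C))%:E).
    by apply: ereal_inf_lbound; exists (inr y) => //; exists y.
  by rewrite lee_fin (glue_cross_le Cxy).
- apply: ge_ereal_sup => _ [_ [y _ <-] <-].
  have [x Cxy] := corr_right C y.
  apply: (@le_trans _ _ (mdist (inl x : glue C) (inr y : glue C))%:E).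
    by apply: ereal_inf_lbound; exists (inl x) => //; exists x.
  by rewrite lee_fin (glue_cross_le Cxy).
Qed.

(** Points correspond when their images in a common space are at distance at most [r]. The strict
    inequality provides partners although the infima need not be attained. *)
Lemma dGH_lt_correspondence (r : R) :
  (dGH X Y < r%:E)%E -> $| correspondence X Y r |.
Proof.
move=> /ereal_inf_lt[_ [s [Z [f [g [fE gE hs]]]] <-]]; rewrite lte_fin => sr.
have {hs} := hs; rewrite /hausdorff_dist ge_max => /andP[hl hr].
constructor; exists (fun x y => mdist (f x) (g y) <= r).
- move=> x.
  have : (ereal_inf [set (mdist (f x) b)%:E | b in range g] < r%:E)%E.
    apply: le_lt_trans (_ : s%:E < _)%E; last by rewrite lte_fin.
    apply: le_trans hl; apply: ereal_sup_ubound.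
    by exists (f x) => //; exists x.
  by move=> /ereal_inf_lt[_ [_ [y _ <-] <-]]; rewrite lte_fin => /ltW; exists y.
- move=> y.
  have : (ereal_inf [set (mdist a (g y))%:E | a in range f] < r%:E)%E.
    apply: le_lt_trans (_ : s%:E < _)%E; last by rewrite lte_fin.
    apply: le_trans hr; apply: ereal_sup_ubound.
    by exists (g y) => //; exists y.
  by move=> /ereal_inf_lt[_ [_ [x _ <-] <-]]; rewrite lte_fin => /ltW; exists x.
- move=> x x' y y' xy x'y'; rewrite -fE -gE ler_norml; apply/andP; split.
  + have := metric_triangle (g y) (f x) (g y').
    have := metric_triangle (f x) (f x') (g y').
    by rewrite (metric_sym (g y) (f x)); lra.
  + have := metric_triangle (f x) (g y) (f x').
    have := metric_triangle (g y) (g y') (f x').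
    by rewrite (metric_sym (g y') (f x')); lra.
Qed.

End GromovHausdorff.

(** * Extremal points of a finite planar set *)

Lemma finite_argmax (R : realType) (T : Type) (A : set T) (f : T -> R) :
  finite_set A -> A !=set0 -> exists2 a, A a & forall b, A b -> f b <= f a.
Proof.
elim/Pchoice: T => T in A f *.
move=> /finite_seqP[s ->]; elim: s => [|x s ih]; first by case=> x.
move=> _; have [->|s0] := eqVneq s [::].
  by exists x => [|y] /=; rewrite !inE// => /eqP ->.
have [a /= sa amax] : exists2 a, a \in s & forall b, b \in s -> f b <= f a.
  by apply: ih; case: s s0 => // y s _; exists y; rewrite /= mem_head.
have [fxa|fax] := leP (f x) (f a).
  exists a => [|b] /=; rewrite inE ?sa ?orbT//.
  by move=> /orP[/eqP->//|/amax].
exists x => [|b] /=; rewrite inE ?eqxx//.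
by move=> /orP[/eqP->//|/amax /le_trans]; apply; exact: ltW.
Qed.

Lemma finite_argmin (R : realType) (T : Type) (A : set T) (f : T -> R) :
  finite_set A -> A !=set0 -> exists2 a, A a & forall b, A b -> f a <= f b.
Proof.
move=> finA A0; have [a Aa amax] := finite_argmax (fun x => - f x) finA A0.
by exists a => // b /amax; rewrite lerN2.
Qed.

(** If every point of [A] failed at some positive [e], the least of these finitely many values would
    admit no solution. This is how arbitrarily small errors are removed. *)
Lemma finite_exists_limit (R : realType) (T : Type) (A : set T)
    (P : T -> R -> Prop) : finite_set A ->
  (forall x e e', e <= e' -> P x e -> P x e') ->
  (forall e, 0 < e -> exists2 x, A x & P x e) ->
  exists2 x, A x & forall e, 0 < e -> P x e.
Proof.
move=> finA Pmono Pe.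
have A0 : A !=set0 by have [x Ax _] := Pe 1 ltr01; exists x.
apply: contrapT => noP.
have /choice[g gP] : forall x, exists e, A x -> 0 < e /\ ~ P x e.
  move=> x; have [Ax|NAx] := pselect (A x); last by exists 0.
  apply: contrapT => nog; apply: noP; exists x => // e e0.
  by apply: contrapT => nP; apply: nog; exists e.
have [a Aa amin] := finite_argmin g finA A0.
have [ga0 _] := gP a Aa; have [x Ax Px] := Pe _ ga0.
by have [_ []] := gP x Ax; exact: Pmono (amin x Ax) Px.
Qed.

(** The product is T1, a singleton being the intersection of two preimages of closed points. For
    finite spaces the closures in [Ext] and [M] therefore add nothing. *)
Lemma closed_finite_ereal_real (R : realType) (A : set (\bar R * R)) :
  finite_set A -> closed A.
Proof.
move: A; apply/accessible_finite_set_closed => p q pq.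
exists (~` [set q]); rewrite !inE /=; split; first last.
- by move=> /(_ erefl).
- exact/eqP.
rewrite openC.
have -> : [set q] = fst @^-1` [set q.1] `&` snd @^-1` [set q.2].
  apply/seteqP; split => [_ -> //|[a b] [/= -> ->]].
  by case: q pq.
apply: closedI; apply: preimage_closed.
- by move=> x _; exact: cvg_fst.
- exact/accessible_closed_set1/hausdorff_accessible/ereal_hausdorff.
- by move=> x _; exact: cvg_snd.
- exact/accessible_closed_set1/hausdorff_accessible/Rhausdorff.
Qed.

(** * Extremal points and the branches of M_n *)

Section ExtremalPoints.
Context (R : realType) (X : metricType R) (n : nat).
Hypothesis AD_finite : finite_set (AD X n).
Hypothesis AD_fin_num : forall p, AD X n p -> p.1 \is a fin_num.

Local Notation D := (diam [set: X]).
Local Notation level p := (fine p.1 + 2 * p.2).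

Let closure_AD : closure (AD X n) = AD X n.
Proof. by apply/esym; apply/closure_id; exact: closed_finite_ereal_real. Qed.

Lemma Ext_sub_AD : Ext X n `<=` AD X n.
Proof. by move=> p []; rewrite closure_AD. Qed.

Lemma Ext_finite : finite_set (Ext X n).
Proof. exact: sub_finite_set Ext_sub_AD AD_finite. Qed.

Let closure_Ext : closure (Ext X n) = Ext X n.
Proof.
apply/esym; apply/closure_id; apply: closed_finite_ereal_real.
exact: Ext_finite.
Qed.

Lemma Ext_fin_num p : Ext X n p -> p.1 \is a fin_num.
Proof. by move=> /Ext_sub_AD/AD_fin_num. Qed.

Lemma Ext_maximal p q : Ext X n p -> AD X n q ->
  fine p.1 <= fine q.1 -> q.2 <= p.2 -> q = p.
Proof.
move=> Ep Aq pq1 pq2; have [_ Np] := Ep; apply: contrapT => neq; apply: Np.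
exists q; split => //; first by rewrite closure_AD.
by rewrite -(fineK (Ext_fin_num Ep)) -(fineK (AD_fin_num Aq)) lee_fin.
Qed.

(** A maximizer of [alpha - d] among the pairs dominating [p] is extremal: passing to a dominating
    pair cannot decrease [alpha - d], and preserves it only if both coordinates agree. *)
Lemma Ext_dominates p : AD X n p ->
  exists q, [/\ Ext X n q, fine p.1 <= fine q.1 & q.2 <= p.2].
Proof.
move=> Ap.
pose B := AD X n `&` [set q | fine p.1 <= fine q.1 /\ q.2 <= p.2].
have [||q [Aq [pq1 pq2]] qmax] :=
    @finite_argmax R _ B (fun q => fine q.1 - q.2).
- by apply: sub_finite_set AD_finite => q [].
- by exists p; split.
exists q; split => //; split; first by rewrite closure_AD.
move=> [q' []]; rewrite closure_AD => Aq' q'q.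
rewrite -(fineK (AD_fin_num Aq)) -(fineK (AD_fin_num Aq')) lee_fin => l1 l2.
have : B q' by split => //; split; [exact: le_trans l1|exact: le_trans pq2].
move=> /qmax ?; apply: q'q.
have e1 : fine q'.1 = fine q.1 by lra.
have e2 : q'.2 = q.2 by lra.
have e1' : q'.1 = q.1.
  by rewrite -(fineK (AD_fin_num Aq)) -(fineK (AD_fin_num Aq')) e1.
by rewrite (surjective_pairing q') (surjective_pairing q) e1' e2.
Qed.

(** Extremal points are pairwise incomparable, so along [Ext] both coordinates, and with them the
    level, increase together. *)
Lemma Ext_level_mono p q : Ext X n p -> Ext X n q -> level p <= level q ->
  fine p.1 <= fine q.1 /\ p.2 <= q.2.
Proof.
move=> Ep Eq pq; split; rewrite leNgt; apply/negP => lt.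
- have := Ext_maximal Eq (Ext_sub_AD Ep) (ltW lt).
  have [le2 /(_ isT) pqE|lt2 _] := leP p.2 q.2; last by lra.
  by move: lt; rewrite pqE ltxx.
- have := Ext_maximal Ep (Ext_sub_AD Eq).
  have [le1 /(_ isT (ltW lt)) pqE|lt1 _] := leP (fine p.1) (fine q.1).
    by move: lt; rewrite pqE ltxx.
  by lra.
Qed.

Lemma Pi_plusE p : p.1 \is a fin_num -> Pi_plus X p <-> D <= level p.
Proof. by move=> pfin; rewrite /Pi_plus /= -(fineK pfin) -EFinD lee_fin. Qed.

Lemma Pi_minusE p : p.1 \is a fin_num -> Pi_minus X p <-> level p <= D.
Proof. by move=> pfin; rewrite /Pi_minus /= -(fineK pfin) -EFinD lee_fin. Qed.

Lemma dist_lineE p : dist_line X p = Num.sqrt ((level p - D) ^+ 2 / 5).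
Proof.
set s := level p - D; apply/le_anti/andP; split.
- apply: ge_inf; first by exists 0 => _ [q _ <-]; exact: sqrtr_ge0.
  (* The foot of the perpendicular: the normal vector (1, 2) has squared length 5. *)
  exists (fine p.1 - s / 5, p.2 - 2 * s / 5) => /=; first by rewrite /s; lra.
  by congr Num.sqrt; field.
- apply: lb_le_inf.
    exists (Num.sqrt ((fine p.1 - D) ^+ 2 + (p.2 - 0) ^+ 2)), (D, 0) => //=.
    by lra.
  move=> _ [q /= qD <-]; apply: ler_wsqrtr.
  have -> : s = (fine p.1 - q.1) + 2 * (p.2 - q.2) by rewrite /s -qD; ring.
  (* Cauchy-Schwarz for (1, 2) and (u, w): the defect in (u + 2w)^2 <= 5 (u^2 + w^2) is (2u -
     w)^2. *)
  have := sqr_ge0 (2 * (fine p.1 - q.1) - (p.2 - q.2)).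
  move: (fine p.1 - q.1) (p.2 - q.2) => u w; nra.
Qed.

Lemma dist_line_le p q : (dist_line X p <= dist_line X q) =
  (`|level p - D| <= `|level q - D|).
Proof.
rewrite !dist_lineE ler_sqrt ?divr_ge0 ?sqr_ge0// ler_pM2r ?invr_gt0//.
by rewrite -(real_normK (num_real (level p - D)))
  -(real_normK (num_real (level q - D))) ler_sqr ?nnegrE.
Qed.

Lemma closest_to_lineP S : finite_set S -> S !=set0 ->
  S (closest_to_line X S) /\ forall q, S q ->
    `|level (closest_to_line X S) - D| <= `|level q - D|.
Proof.
move=> finS S0; have [p Sp pmin] := finite_argmin (@dist_line R X) finS S0.
have [|Sc cmin] := @xgetPex _ (0%E, 0) [set p | S p /\
    forall q, S q -> dist_line X p <= dist_line X q]; first by exists p.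
by split => // q Sq; rewrite -dist_line_le; exact: cmin.
Qed.

(** The branches of [M], with closest points replaced by order conditions: [p] has the largest first
    coordinate among the extremal points on or below the line. In [MDominated] its projection to the
    line is dominated by the extremal point [q]; in [MLine] an extremal point above the line
    dominates this projection only by coinciding with it. The second branch of [M] is an instance of
    [MLine]. *)
Inductive M_spec : set (\bar R * R) -> Prop :=
| MPlus of Ext X n `<=` Pi_plus X : M_spec (Ext X n)
| MDominated p q of Ext X n p & level p <= D &
    (forall q, Ext X n q -> level q <= D -> fine q.1 <= fine p.1) &
    Ext X n q & D <= level q & fine p.1 + 2 * q.2 <= D :
    M_spec (Ext X n `&` Pi_plus X)
| MLine p of Ext X n p & level p <= D &
    (forall q, Ext X n q -> level q <= D -> fine q.1 <= fine p.1) &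
    (forall q, Ext X n q -> D <= level q ->
       D < fine p.1 + 2 * q.2 \/ q = on_line X p.1) :
    M_spec ((Ext X n `&` Pi_plus X) `|` [set on_line X p.1]).

Lemma on_line_level a : level (on_line X a) = D.
Proof. by rewrite /=; lra. Qed.

Lemma MP : M_spec (M X n).
Proof.
rewrite /M; case: asboolP => [EP|NEP]; first exact: MPlus.
have [p0 E0 lp0] : exists2 p, Ext X n p & level p < D.
  apply: contrapT => no; apply: NEP => p Ep.
  apply/Pi_plusE; first exact: Ext_fin_num.
  by rewrite leNgt; apply/negP => lp; apply: no; exists p.
case: asboolP => [EM|NEM].
- have [p Ep pmax] := finite_argmax (fun q => fine q.1) Ext_finite
    (ex_intro _ p0 E0).
  have lp : level p <= D by apply/Pi_minusE; [exact: Ext_fin_num|exact: EM].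
  have aE : alpha_plus X n = p.1.
    apply/le_anti/andP; split.
    - apply: ge_ereal_sup => _ [P PP <-].
      have AP : AD X n (alpha P, diam_partition P) by exists P.
      have [q [Eq le1 _]] := Ext_dominates AP.
      have := AD_fin_num AP => /= /fineK <-.
      rewrite -(fineK (Ext_fin_num Ep)) lee_fin.
      exact: le_trans le1 (pmax _ Eq).
    - have [P PP <-] := Ext_sub_AD Ep.
      by apply: ereal_sup_ubound; exists P.
  (* Such a point lies on the line, at a level not below that of [p], so its first coordinate is
     both at least and at most that of [p]. *)
  have on_plus q : Ext X n q -> D <= level q -> q = on_line X p.1.
    move=> Eq Dq; have qD : level q <= D.
      by apply/Pi_minusE; [exact: Ext_fin_num|exact: EM].
    have [|le1 le2] := Ext_level_mono Ep Eq; first exact: le_trans lp Dq.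
    have := pmax _ Eq => ge1.
    have a1 : fine q.1 = fine p.1 by apply/le_anti; rewrite ge1 le1.
    rewrite (surjective_pairing q) /on_line; congr pair; last by lra.
    by rewrite -(fineK (Ext_fin_num Eq)) -(fineK (Ext_fin_num Ep)) a1.
  have -> : [set on_line X (alpha_plus X n)] =
      (Ext X n `&` Pi_plus X) `|` [set on_line X p.1].
    rewrite aE; apply/seteqP; split=> [q ->|q [[Eq /Pi_plusE]|->//]].
      by right.
    by move=> /(_ (Ext_fin_num Eq)) Dq; rewrite [q]on_plus.
  by apply: MLine => // q Eq; [move=> _; exact: pmax|right; exact: on_plus].
- have [p1 E1 lp1] : exists2 p, Ext X n p & D < level p.
    apply: contrapT => no; apply: NEM => p Ep.
    apply/Pi_minusE; first exact: Ext_fin_num.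
    by rewrite leNgt; apply/negP => lp; apply: no; exists p.
  rewrite !closure_Ext.
  set p_ := closest_to_line X (_ `&` Pi_minus X).
  set q_ := closest_to_line X (_ `&` Pi_plus X).
  have [||[Ep pM] pmin] := @closest_to_lineP (Ext X n `&` Pi_minus X).
  - by apply: sub_finite_set Ext_finite => ? [].
  - exists p0; split => //; apply/Pi_minusE; first exact: Ext_fin_num.
    exact: ltW.
  have [||[Eq qP] qmin] := @closest_to_lineP (Ext X n `&` Pi_plus X).
  - by apply: sub_finite_set Ext_finite => ? [].
  - exists p1; split => //; apply/Pi_plusE; first exact: Ext_fin_num.
    exact: ltW.
  rewrite -/p_ -/q_ in Ep Eq pmin qmin pM qP *.
  have {}pM : level p_ <= D by apply/Pi_minusE => //; exact: Ext_fin_num.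
  have {}qP : D <= level q_ by apply/Pi_plusE => //; exact: Ext_fin_num.
  (* Below the line, closest means highest level, hence largest first coordinate; above it, closest
     means lowest level, hence smallest second coordinate. *)
  have pmax q : Ext X n q -> level q <= D -> fine q.1 <= fine p_.1.
    move=> E lq; suff: level q <= level p_ by move=> /(Ext_level_mono E Ep)[].
    have : `|level p_ - D| <= `|level q - D|.
      by apply: pmin; split => //; apply/Pi_minusE => //; exact: Ext_fin_num.
    by rewrite !ler0_norm ?subr_le0//; lra.
  have qmax q : Ext X n q -> D <= level q -> q_.2 <= q.2.
    move=> E lq; suff: level q_ <= level q by move=> /(Ext_level_mono Eq E)[].
    have : `|level q_ - D| <= `|level q - D|.
      by apply: qmin; split => //; apply/Pi_plusE => //; exact: Ext_fin_num.
    by rewrite !ger0_norm ?subr_ge0//; lra.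
  have h := @Pi_minusE (p_.1, q_.2) (Ext_fin_num Ep).
  case: asboolP => pq; first exact: (@MDominated p_ q_) (iffLR h pq).
  apply: MLine => // q E lq; left.
  apply: lt_le_trans (_ : fine p_.1 + 2 * q_.2 <= _).
    by rewrite ltNge; apply/negP => /(iffRL h).
  by rewrite lerD2l ler_pM2l// qmax.
Qed.

Lemma M_finite : finite_set (M X n).
Proof.
have finP : finite_set (Ext X n `&` Pi_plus X).
  by apply: sub_finite_set Ext_finite => ? [].
by case: MP => // *; [exact: Ext_finite|rewrite finite_setU].
Qed.

Lemma M_fin_num p : M X n p -> p.1 \is a fin_num.
Proof.
case: MP => [_ /Ext_fin_num//|_ _ _ _ _ _ _ _ [/Ext_fin_num]//|].
by move=> p' Ep _ _ _ [[/Ext_fin_num]//|->]; exact: Ext_fin_num Ep.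
Qed.

Lemma M_level_ge p : M X n p -> D <= level p.
Proof.
have EP q : Ext X n q -> Pi_plus X q -> D <= level q.
  by move=> Eq /(Pi_plusE (Ext_fin_num Eq)).
case: MP => [sub Ep|_ _ _ _ _ _ _ _ []|p' _ _ _ _ [[]|->]]; try exact: EP.
- exact/EP/sub.
- by rewrite on_line_level.
Qed.

Lemma M_ge0 p : (forall q, AD X n q -> 0 <= fine q.1 /\ 0 <= q.2) ->
  M X n p -> 0 <= fine p.1 /\ 0 <= p.2.
Proof.
move=> AD_ge0.
case: MP => [_ /Ext_sub_AD/AD_ge0//|_ _ _ _ _ _ _ _ [/Ext_sub_AD/AD_ge0]//|].
move=> p' /Ext_sub_AD/AD_ge0[? ?] lp' _ _ [[/Ext_sub_AD/AD_ge0]//|->] /=.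
by split => //; lra.
Qed.

(** Only the added point on the line needs care. An extremal point on or above the line that it
    dominates, other than itself, would by extremality be the point [m] it is projected from,
    against the strict inequality of [MLine]; the same inequality excludes extremal points
    dominating it. *)
Lemma M_antichain p q : M X n p -> M X n q ->
  fine p.1 <= fine q.1 -> q.2 <= p.2 -> q = p.
Proof.
have EE p' q' := fun (Ep : Ext X n p') (Eq : Ext X n q') =>
  Ext_maximal Ep (Ext_sub_AD Eq).
case: MP => [_ Ep Eq|_ _ _ _ _ _ _ _ [Ep _] [Eq _]|]; try exact: EE.
move=> m Em lm mmax mstrict [[Ep /(Pi_plusE (Ext_fin_num Ep)) lp]|->];
  move=> [[Eq /(Pi_plusE (Ext_fin_num Eq)) lq]|->] //=.
- exact: EE.
- move=> pm mp; have [|->//] := mstrict p Ep lp.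
  have [|le1 le2] := Ext_level_mono Em Ep; first exact: le_trans lm lp.
  have mE := EE _ _ Ep Em pm le2; move=> str; exfalso.
  by rewrite -mE in str; lra.
- by move=> mq qm; have [str|//] := mstrict q Eq lq; exfalso; lra.
Qed.

Lemma M_dominated p : M X n p ->
  exists q, [/\ AD X n q, fine p.1 <= fine q.1 & q.2 <= p.2].
Proof.
case: MP => [_ Ep|_ _ _ _ _ _ _ _ [Ep _]|m Em lm _ _ [[Ep _]|->]];
  try by exists p; split => //; exact: Ext_sub_AD.
by exists m; split => //=; [exact: Ext_sub_AD|lra].
Qed.

(** The maximum is the second coordinate after raising a low pair to the line. A dominating extremal
    point strictly above the line is in [M]; one on or below it has first coordinate at most that of
    [m], and the projection of [m], or the point dominating that projection, serves instead. *)
Lemma M_dominates p : AD X n p -> exists q, [/\ M X n q,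
  fine p.1 <= fine q.1 & q.2 <= Num.max p.2 ((D - fine p.1) / 2)].
Proof.
move=> /Ext_dominates[q [Eq pq1 pq2]].
suff [r [Mr qr1 qr2]] : exists r, [/\ M X n r,
    fine q.1 <= fine r.1 & r.2 <= Num.max q.2 ((D - fine q.1) / 2)].
  exists r; split => //; first exact: le_trans qr1.
  apply: le_trans qr2 _; rewrite ge_max !le_max pq2 /=; apply/orP; right.
  by lra.
case: MP => [_|m m' Em lm mmax Em' lm' mm'|m Em lm mmax _].
- by exists q; split => //; rewrite le_max lexx.
- have [lq|lq] := leP (level q) D; last first.
    exists q; split; rewrite ?le_max ?lexx //; split => //.
    by apply/(Pi_plusE (Ext_fin_num Eq))/ltW.
  exists m'; split.
  + by split => //; apply/(Pi_plusE (Ext_fin_num Em')).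
  + by have [|] := Ext_level_mono Eq Em' => //; exact: le_trans lq lm'.
  + rewrite le_max; apply/orP; right; have := mmax q Eq lq; lra.
- have [lq|lq] := leP (level q) D; last first.
    exists q; split; rewrite ?le_max ?lexx //; left; split => //.
    by apply/(Pi_plusE (Ext_fin_num Eq))/ltW.
  exists (on_line X m.1); split; first by right.
  + exact: mmax.
  + rewrite le_max; apply/orP; right => /=; have := mmax q Eq lq; lra.
Qed.

End ExtremalPoints.

(* Together with [diam X - l <= v], [feasible (AD X n) l v] amounts to
   2 d_GH(l Delta_n, X) <= v. *)
Definition feasible (R : realType) (S : set (\bar R * R)) (l v : R) :=
  exists2 p, S p & ((l - v)%:E <= p.1)%E /\ p.2 <= v.

(** * M_n and feasibility determine each other *)

Section Envelope.
Context (R : realType) (n : nat).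
Implicit Types X Y : metricType R.

Lemma feasible_M X l v : finite_set (AD X n) ->
  (forall p, AD X n p -> p.1 \is a fin_num) ->
  diam [set: X] - l <= v -> feasible (M X n) l v <-> feasible (AD X n) l v.
Proof.
move=> finX numX lv; split=> [[p Mp [p1 p2]]|[p Ap [p1 p2]]].
- have [q [Aq pq1 pq2]] := M_dominated finX numX Mp.
  exists q => //; split; last exact: le_trans p2.
  apply: le_trans p1 _; rewrite -(fineK (M_fin_num finX numX Mp)).
  by rewrite -(fineK (numX _ Aq)) lee_fin.
- have [q [Mq pq1 pq2]] := M_dominates finX numX Ap.
  have {}p1 : l - v <= fine p.1 by rewrite -lee_fin (fineK (numX _ Ap)).
  exists q => //; split.
    by rewrite -(fineK (M_fin_num finX numX Mq)) lee_fin; lra.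
  (* From [l - v <= alpha] and [D - l <= v] follows [D - alpha <= 2 * v], so raising to the line
     keeps the second coordinate below [v]. *)
  by apply: le_trans pq2 _; rewrite ge_max p2 /=; lra.
Qed.

Lemma M_dominated_feasible X Y p :
  finite_set (AD X n) -> finite_set (AD Y n) ->
  (forall q, AD X n q -> q.1 \is a fin_num) ->
  (forall q, AD Y n q -> q.1 \is a fin_num) ->
  (forall q, AD X n q -> 0 <= fine q.1 /\ 0 <= q.2) ->
  diam [set: X] = diam [set: Y] ->
  (forall l v v', 0 < l -> v < v' -> diam [set: X] - l <= v ->
     feasible (AD X n) l v -> feasible (AD Y n) l v') ->
  M X n p -> exists q, [/\ M Y n q, fine p.1 <= fine q.1 & q.2 <= p.2].
Proof.
move=> finX finY numX numY ge0X dE XY Mp.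
have [p1 p2] := M_ge0 finX numX ge0X Mp.
have lp := M_level_ge finX numX Mp.
pose P (q : \bar R * R) e := ((fine p.1 - e)%:E <= q.1)%E /\ q.2 <= p.2 + e.
have [||q Mq qP] := @finite_exists_limit R _ _ P (M_finite finY numY).
- move=> q e e' ee' [q1 q2]; split; last by lra.
  by apply: le_trans q1; rewrite lee_fin; lra.
(* The test values are [v = d + e / 2] and [l = alpha + v]: the slack makes [l] positive even for
   [alpha = d = 0], and leaves room for [v' = d + e]. *)
- move=> e e0; pose v := p.2 + e / 2.
  have [||q Mq [q1 q2]] :=
    iffRL (@feasible_M Y (fine p.1 + v) (p.2 + e) finY numY _).
  + by rewrite -dE /v; lra.
  + apply: (XY _ v); rewrite /v; try lra.
    apply/feasible_M => //; first by lra.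
    exists p => //; split; last by lra.
    by rewrite -(fineK (M_fin_num finX numX Mp)) lee_fin; lra.
  + exists q => //; split; last by lra.
    by apply: le_trans q1; rewrite lee_fin /v; lra.
exists q; split => //.
- apply/ler_addgt0Pr => e e0; have [q1 _] := qP e e0.
  by move: q1; rewrite -(fineK (M_fin_num finY numY Mq)) lee_fin; lra.
- by apply/ler_addgt0Pr => e e0; have [_ q2] := qP e e0.
Qed.

(** A point [p] of [M X n] is dominated by some [q] in [M Y n], and [q] by some [r] in [M X n].
    Incomparability within [M X n] gives [r = p], which squeezes [q] to [p]. *)
Lemma M_sub_feasible X Y :
  finite_set (AD X n) -> finite_set (AD Y n) ->
  (forall q, AD X n q -> q.1 \is a fin_num) ->
  (forall q, AD Y n q -> q.1 \is a fin_num) ->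
  (forall q, AD X n q -> 0 <= fine q.1 /\ 0 <= q.2) ->
  (forall q, AD Y n q -> 0 <= fine q.1 /\ 0 <= q.2) ->
  diam [set: X] = diam [set: Y] ->
  (forall l v v', 0 < l -> v < v' -> diam [set: X] - l <= v ->
     feasible (AD X n) l v -> feasible (AD Y n) l v') ->
  (forall l v v', 0 < l -> v < v' -> diam [set: X] - l <= v ->
     feasible (AD Y n) l v -> feasible (AD X n) l v') ->
  M X n `<=` M Y n.
Proof.
move=> finX finY numX numY ge0X ge0Y dE XY YX p Mp.
have [q [Mq pq1 pq2]] := M_dominated_feasible finX finY numX numY ge0X dE XY Mp.
have [|r [Mr qr1 qr2]] :=
  M_dominated_feasible finY finX numY numX ge0Y (esym dE) _ Mq.
  by rewrite -dE.
have rE := M_antichain finX numX Mp Mr (le_trans pq1 qr1) (le_trans qr2 pq2).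
rewrite rE in qr1 qr2.
suff -> : p = q by [].
have e1 : fine p.1 = fine q.1 by apply/le_anti; rewrite pq1.
have e2 : p.2 = q.2 by apply/le_anti; rewrite qr2.
rewrite (surjective_pairing p) (surjective_pairing q) e2.
rewrite -(fineK (M_fin_num finX numX Mp)) e1.
by rewrite (fineK (M_fin_num finY numY Mq)).
Qed.

End Envelope.

(** * Partitions of finite metric spaces *)

Lemma card_leTP (T U : Type) :
  [set: T] #<= [set: U] <-> exists f : T -> U, injective f.
Proof.
elim/Ppointed: U => U.
  rewrite emptyE; split=> [/eqP T0|[f _]].
    have noT (t : T) : False by have : [set: T] t by []; rewrite T0.
    by exists (fun t => False_rect U (noT t)) => t; case: (noT t).
  by apply/eqP; rewrite -subset0 => t _; exact: no (f t).
split=> [/pcard_injP[f finj]|[f finj]].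
  by exists f => x y; apply: finj; rewrite inE.
by apply/pcard_injP; exists f => x y _ _; exact: finj.
Qed.

Lemma finite_enum (T : Type) : finite_set [set: T] ->
  exists m (e : 'I_m -> T), injective e /\ forall x, exists k, e k = x.
Proof.
elim/Pchoice: T => T /finite_seqP[s sE].
exists (size (undup s)), (tnth (in_tuple (undup s))); split.
  by apply/tuple_uniqP; exact: undup_uniq.
move=> x; have : x \in undup s.
  have : [set: T] x by [].
  by rewrite sE /= mem_undup.
by move=> /(tnthP (in_tuple _))[k ->]; exists k.
Qed.

Lemma finite_card_lt_inj (T U : Type) : finite_set [set: T] ->
  ~ ([set: U] #<= [set: T]) -> exists f : T -> U, injective f.
Proof.
move=> finT UT; apply/card_leTP; have /finite_setP[m Tm] := finT.
rewrite (card_le_eql Tm).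
have [/finite_setP[k Uk]|] := pselect (finite_set [set: U]); last first.
  move=> infU; apply: card_le_trans (iffLR (infiniteP _) infU).
  exact: card_leT.
rewrite (card_le_eqr Uk) card_le_II leqNgt; apply/negP => km; apply: UT.
by rewrite (card_le_eql Uk) (card_le_eqr Tm) card_le_II ltnW.
Qed.

(* A maximal refinement is onto: otherwise some point of a fibre with at least
   two points could be moved to a value that is not taken. *)
Lemma surjective_refinement (T : finType) (n : nat) (f : T -> 'I_n) :
  (n <= #|T|)%N -> exists2 g : T -> 'I_n, (forall i, exists x, g x = i) &
    forall x y, g x = g y -> f x = f y.
Proof.
move=> nT.
pose P (g : {ffun T -> 'I_n}) :=
  [forall x, forall y, (g x == g y) ==> (f x == f y)].
have P0 : P [ffun x => f x].
  by apply/forallP => x; apply/forallP => y; rewrite !ffunE implybb.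
pose F (g : {ffun T -> 'I_n}) := #|[set g x | x : T]%SET|.
case: (@arg_maxnP _ [ffun x => f x] P F P0) => g Pg gmax.
have gref x y : g x = g y -> f x = f y.
  by move=> gxy; move/forallP/(_ x)/forallP/(_ y): Pg; rewrite gxy eqxx => /eqP.
exists g => // i; apply: contrapT => gi.
have gNi x : g x != i by apply/eqP => gx; apply: gi; exists x.
have /injectivePn[x [y xy gxy]] : ~~ injectiveb g.
  apply/negP => /injectiveP ginj.
  have : (F g < n)%N.
    rewrite -[X in (_ < X)%N]card_ord; apply: proper_card.
    apply/properP; split; first exact/fintype.subsetP.
    exists i => //; apply/imsetP => -[x _ ix].
    by move: (gNi x); rewrite -ix eqxx.
  by rewrite /F card_imset// ltnNge nT.
pose g' := [ffun z => if z == x then i else g z].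
have Pg' : P g'.
  apply/forallP => a; apply/forallP => b; apply/implyP; rewrite !ffunE.
  have [->|ax] := eqVneq a x; have [->|bx] := eqVneq b x => //.
  - by rewrite eq_sym (negbTE (gNi b)).
  - by rewrite (negbTE (gNi a)).
  - by move=> /eqP/gref/eqP.
suff : (F g < F g')%N by rewrite ltnNge; have := gmax _ Pg' => /= ->.

apply: proper_card; apply/properP; split.
  apply/fintype.subsetP => _ /imsetP[z _ ->]; apply/imsetP.
  have [->|zx] := eqVneq z x; last by exists z; rewrite // ffunE (negbTE zx).
  by exists y; rewrite // ffunE eq_sym (negbTE xy).
exists i; last by apply/imsetP => -[z _ iz]; move: (gNi z); rewrite -iz eqxx.
by apply/imsetP; exists x; rewrite // ffunE eqxx.
Qed.

Section FiniteMetricSpace.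
Context (R : realType) (X : metricType R).
Hypothesis X_finite : finite_set [set: X].
Local Notation D := (diam [set: X]).

Let dist_has_ubound (A : set X) :
  has_ubound [set mdist a b | a in A & b in A].
Proof.
have [[a Aa]|A0] := pselect (A !=set0); last first.
  by exists 0 => ? [a Aa]; case: A0; exists a.
have [||p _ pmax] := @finite_argmax R _ ([set: X] `*` [set: X])
  (fun p => mdist p.1 p.2).
- exact: finite_setX.
- by exists (a, a).
by exists (mdist p.1 p.2) => _ [b _ [c _ <-]]; exact: (pmax (b, c)).
Qed.

Lemma diam_leP (A : set X) v : A !=set0 ->
  diam A <= v <-> forall x y, A x -> A y -> mdist x y <= v.
Proof.
move=> [a Aa]; split=> [Av x y Ax Ay|Av].
  apply: le_trans Av; apply: ub_le_sup; first exact: dist_has_ubound.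
  by exists x => //; exists y.
apply: ge_sup; first by exists (mdist a a), a => //; exists a.
by move=> _ [x Ax [y Ay <-]]; exact: Av.
Qed.

Lemma dist_le_diam (x y : X) : mdist x y <= D.
Proof.
have [/(_ (lexx _)) h _] := @diam_leP setT D (ex_intro _ x I).
exact: h.
Qed.

Lemma set_dist_geP (A B : set X) c : A !=set0 -> B !=set0 ->
  c <= set_dist A B <-> forall x y, A x -> B y -> c <= mdist x y.
Proof.
move=> [a Aa] [b Bb]; split=> [cAB x y Ax By|cAB].
  apply: le_trans cAB _; apply: ge_inf; last by exists x => //; exists y.
  by exists 0 => _ [? _ [? _ <-]]; exact: mdist_ge0.
apply: lb_le_inf; first by exists (mdist a b), a => //; exists b.
by move=> _ [x Ax [y By <-]]; exact: cAB.
Qed.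

Section Partition.
Context (n : nat) (P : 'I_n -> set X).
Hypothesis partP : partitions P.

Lemma partitions_neq0 i : P i !=set0.
Proof. by have [_ _] := partP; exact. Qed.

Lemma partitions_cover x : exists i, P i x.
Proof.
have [cov _ _] := partP; have : [set: X] x by [].
by rewrite -cov => -[i _ Pix]; exists i.
Qed.

Lemma partitions_inj i j x : P i x -> P j x -> i = j.
Proof. by have [_ triv _] := partP => Pi Pj; apply: triv => //; exists x. Qed.

Lemma diam_partition_leP v : (0 < n)%N -> diam_partition P <= v <->
  forall i x y, P i x -> P i y -> mdist x y <= v.
Proof.
move=> n0; split=> [Pv i|Pv].
  apply/(diam_leP _ (partitions_neq0 i)); apply: le_trans Pv.
  apply: ub_le_sup; last by exists i.
  exists D => _ [j _ <-]; apply/(diam_leP _ (partitions_neq0 j)) => x y _ _.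
  exact: dist_le_diam.
apply: ge_sup; first by exists (diam (P (Ordinal n0))), (Ordinal n0).
by move=> _ [i _ <-]; apply/(diam_leP _ (partitions_neq0 i)) => x y; exact: Pv.
Qed.

Lemma alpha_geP c : (c%:E <= alpha P)%E <->
  forall i j x y, i <> j -> P i x -> P j y -> c <= mdist x y.
Proof.
split=> [cP i j x y ij|cP].
  have h := set_dist_geP c (partitions_neq0 i) (partitions_neq0 j).
  apply: h.1; rewrite -lee_fin; apply: le_trans cP _.
  by apply: ereal_inf_lbound; exists (i, j) => //=; exact/eqP.
apply: le_ereal_inf_tmp => _ [[i j] /= /eqP ij <-]; rewrite lee_fin.
apply/(set_dist_geP c (partitions_neq0 i) (partitions_neq0 j)) => x y.
exact: cP.
Qed.

Lemma alpha_ge0 : (0 <= alpha P)%E.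
Proof. by apply/alpha_geP => *; exact: mdist_ge0. Qed.

Lemma alpha_fin_num : (1 < n)%N -> alpha P \is a fin_num.
Proof.
move=> n1; rewrite ge0_fin_numE; last exact: alpha_ge0.
pose c := set_dist (P (Ordinal (ltnW n1))) (P (Ordinal n1)).
apply: (@le_lt_trans _ _ c%:E); last exact: ltry.
by apply: ereal_inf_lbound; exists (Ordinal (ltnW n1), Ordinal n1).
Qed.

Lemma diam_partition_ge0 : (0 < n)%N -> 0 <= diam_partition P.
Proof.
move=> n0; have [x Px] := partitions_neq0 (Ordinal n0).
apply: le_trans (mdist_ge0 x x) _.
by apply: ((diam_partition_leP (diam_partition P) n0).1 (lexx _) (Ordinal n0)).
Qed.

End Partition.

(** A labelled partition is a colouring of an enumeration of [X], and there are finitely many of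
    these. *)
Lemma AD_finite n : finite_set (AD X n).
Proof.
have [m [e [einj esurj]]] := finite_enum X_finite.
pose part (t : {ffun 'I_m -> 'I_n}) i := [set x | exists2 k, e k = x & t k = i].
apply: (@sub_finite_set _ _
    (range (fun t => (alpha (part t), diam_partition (part t))))).
  move=> _ [P PP <-].
  have /choice[t tP] : forall k, exists i, P i (e k).
    by move=> k; exact: partitions_cover PP _.
  exists [ffun k => t k] => //.
  suff -> : part [ffun k => t k] = P by [].
  apply/funext => i; apply/seteqP; split=> [_ [k <- <-]|x Px].
    by rewrite ffunE.
  have [k kx] := esurj x; exists k => //; rewrite ffunE.
  by apply: (partitions_inj PP (x := x)) => //; rewrite -kx.
exact/finite_image/finite_finset.
Qed.

Lemma AD_fin_num n p : (1 < n)%N -> AD X n p -> p.1 \is a fin_num.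
Proof. by move=> n1 [P PP <-]; exact: alpha_fin_num. Qed.

Lemma AD_ge0 n p : (1 < n)%N -> AD X n p -> 0 <= fine p.1 /\ 0 <= p.2.
Proof.
move=> n1 [P PP <-] /=; split; first by rewrite fine_ge0// alpha_ge0.
by apply: diam_partition_ge0 => //; exact: ltnW.
Qed.

Lemma AD1 : [set: X] !=set0 -> AD X 1 = [set (+oo%E, D)].
Proof.
move=> X0.
have val (P : 'I_1 -> set X) : partitions P ->
    (alpha P, diam_partition P) = (+oo%E, D).
  move=> PP; have PT : P = fun=> [set: X].
    apply/funext => i; apply/seteqP; split => // x _.
    by have [j] := partitions_cover PP x; rewrite !ord1.
  congr pair; last first.
    rewrite /diam_partition PT -[RHS]sup1; congr sup.
    by apply/seteqP; split=> [_ [_ _ <-]//|_ ->]; exists ord0.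
  rewrite /alpha; set S := [set _ | _ in _].
  suff -> : S = set0 by rewrite ereal_inf0.
  by rewrite -subset0 => ? [[i j] /=]; rewrite !ord1 eqxx.
apply/seteqP; split=> [_ [P PP <-]|_ ->]; first by rewrite val.
have PT : @partitions R X 1 (fun=> [set: X]).
  split; last by move=> i _.
  - by apply/seteqP; split => // x _; exists ord0.
  - by move=> i j _ _ _; rewrite !ord1.
by exists (fun=> [set: X]); last exact: val.
Qed.

End FiniteMetricSpace.

(** * Distances to simplexes *)

(* A correspondence of distortion at most [v] between [l Delta_I] and [X]. *)
Definition simplex_close (R : realType) (X : metricType R) (I : Type)
    (l v : R) : Prop :=
  exists C : I -> X -> Prop,
    [/\ forall i, exists x, C i x, forall x, exists i, C i x &
        forall i j x y, C i x -> C j y ->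
          (i = j -> mdist x y <= v) /\ (i <> j -> `|l - mdist x y| <= v)].

Section SimplexClose.
Context (R : realType).
Implicit Types (X Y : metricType R) (I : Type) (l v : R).

Lemma mdist_posSimplex (lam : {posnum R}) I (i j : posSimplex lam I) :
  mdist i j = lam%:num * (i != j)%:R.
Proof. by []. Qed.

Lemma simplex_close_ge0 X I l v : [set: X] !=set0 ->
  simplex_close X I l v -> 0 <= v.
Proof.
move=> [x _] [C [_ Cr Cd]]; have [i Cix] := Cr x.
by have [/(_ erefl) + _] := Cd i i x x Cix Cix; rewrite mdistxx.
Qed.

Lemma simplex_close_dGH X I (lam : {posnum R}) v : [set: X] !=set0 ->
  simplex_close X I lam%:num v ->
  (dGH (posSimplex lam I) X <= (v / 2)%:E)%E.
Proof.
move=> X0 close; have v0 := simplex_close_ge0 X0 close.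
have [C [Cl Cr Cd]] := close.
(* Gluing needs a positive radius, while [v] may be zero. *)
apply/lee_addgt0Pr => e e0; rewrite -EFinD.
apply: correspondence_dGH_le; last by rewrite ltr_wpDl// divr_ge0.
exists C => // i j x y Cix Cjy; rewrite mdist_posSimplex.
have [eqd neqd] := Cd i j x y Cix Cjy.
have [ij|ij] := eqVneq i j; last first.
  by rewrite mulr1; have := neqd (elimN eqP ij); lra.
by rewrite mulr0 sub0r normrN ger0_norm ?mdist_ge0//; have := eqd ij; lra.
Qed.

Lemma dGH_simplex_close X I (lam : {posnum R}) v :
  (dGH (posSimplex lam I) X < (v / 2)%:E)%E -> simplex_close X I lam%:num v.
Proof.
move=> /dGH_lt_correspondence[[C Cl Cr Cd]]; exists C; split => //.
move=> i j x y Cix Cjy; have := Cd i j x y Cix Cjy.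
rewrite mdist_posSimplex (_ : 2 * (v / 2) = v); last by field.
move=> ijxy; split=> ij; move: ijxy.
  by rewrite ij eqxx mulr0 sub0r normrN ger0_norm ?mdist_ge0.
by have /eqP -> : (i : posSimplex lam I) <> j by []; rewrite mulr1.
Qed.

(** The distance is the infimum of [v / 2] over the [v] with [simplex_close], so comparing these
    values of [v] suffices. *)
Lemma dGH_posSimplex_le X Y I (lam : {posnum R}) :
  [set: X] !=set0 -> [set: Y] !=set0 ->
  (forall v, simplex_close X I lam%:num v -> simplex_close Y I lam%:num v) ->
  (dGH (posSimplex lam I) Y <= dGH (posSimplex lam I) X)%E.
Proof.
move=> X0 Y0 XY.
have lt_close r : (dGH (posSimplex lam I) X < r%:E)%E ->
    simplex_close X I lam%:num (2 * r).
  by move=> ltr; apply: dGH_simplex_close; rewrite mulrAC divff// mul1r.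
case E : (dGH (posSimplex lam I) X) => [r||]; last first.
- have /lt_close/(simplex_close_ge0 X0) :
    (dGH (posSimplex lam I) X < (-1)%:E)%E by rewrite E ltNyr.
  by move=> {E} ?; exfalso; lra.
- exact: leey.
apply/lee_addgt0Pr => e e0; rewrite -EFinD.
rewrite (_ : r + e = 2 * (r + e) / 2); last by field.
by apply/simplex_close_dGH/XY/lt_close; rewrite // E lte_fin ltrDl.
Qed.

Lemma simplexE l I (l0 : 0 < l) : simplex l I = posSimplex (PosNum l0) I.
Proof.
by rewrite /simplex; case: pselect => // l0'; rewrite (Prop_irrelevance l0' l0).
Qed.

Lemma simplex0E I : simplex (0 : R) I = posSimplex (1%:pos : {posnum R}) unit.
Proof.
by rewrite /simplex; case: pselect => // l0; have := ltxx (0 : R); rewrite l0.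
Qed.

Lemma simplex_close_bij X (I J : Type) l v (e : I -> J) :
  injective e -> (forall j, exists i, e i = j) ->
  simplex_close X I l v <-> simplex_close X J l v.
Proof.
move=> einj esurj; split=> -[C [Cl Cr Cd]].
- exists (fun j x => exists2 i, e i = j & C i x); split.
  + move=> j; have [i <-] := esurj j; have [x Cix] := Cl i.
    by exists x, i.
  + by move=> x; have [i Cix] := Cr x; exists (e i), i.
  + move=> _ _ x y [i <- Cix] [j <- Cjy]; have [h1 h2] := Cd i j x y Cix Cjy.
    by split=> [/einj//|ij]; apply: h2 => ij'; apply: ij; rewrite ij'.
- exists (fun i => C (e i)); split => //.
  + move=> x; have [j Cjx] := Cr x; have [i ij] := esurj j.
    by exists i; rewrite ij.
  + move=> i j x y Cix Cjy; have [h1 h2] := Cd _ _ x y Cix Cjy.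
    by split=> ij; [apply: h1; rewrite ij|apply: h2 => /einj].
Qed.

Section Finite.
Context (X : metricType R).
Hypotheses (X_finite : finite_set [set: X]) (X_nonempty : [set: X] !=set0).
Local Notation D := (diam [set: X]).

Lemma diamT_leP v : D <= v <-> forall x y : X, mdist x y <= v.
Proof.
have := diam_leP X_finite v X_nonempty => DP.
by split=> [/DP h x y|h]; [exact: h|apply/DP => x y _ _].
Qed.

Lemma simplex_close_diam I l v : 0 <= l -> simplex_close X I l v -> D - l <= v.
Proof.
move=> l0 [C [_ Cr Cd]]; rewrite lerBlDr; apply/diamT_leP => x y.
have [i Cix] := Cr x; have [j Cjy] := Cr y; have [h1 h2] := Cd i j x y Cix Cjy.
have [/h1|/h2] := pselect (i = j); first lra.
by rewrite ler_norml => /andP[? ?]; lra.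
Qed.

(** This handles [simplex 0 I], encoded as a one-point space: the distance to it measures the
    diameter. *)
Lemma simplex_close_unit v : simplex_close X unit 1 v <-> D <= v.
Proof.
split=> [[C [_ Cr Cd]]|/diamT_leP Dv].
  apply/diamT_leP => x y; have [[] Cx] := Cr x; have [[] Cy] := Cr y.
  by have [/(_ erefl)] := Cd tt tt x y Cx Cy.
have [x0 _] := X_nonempty; exists (fun _ _ => True); split => [_|_|[] []//].
- by exists x0.
- by exists tt.
Qed.

(** With more indices than points, two indices share a point, which costs [l]. Conversely, a left
    inverse of an injection of [X] into [I] is a correspondence whose distances all lie between 0
    and [D]. *)
Lemma simplex_close_large I l v : 0 <= l -> ~ ([set: I] #<= [set: X]) ->
  simplex_close X I l v <-> l <= v /\ D - l <= v.
Proof.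
move=> l0 IX; split=> [close|[lv Dlv]].
  split; last exact: simplex_close_diam close.
  have [C [Cl Cr Cd]] := close; have /choice[f fP] := Cl.
  apply: contrapT => lv; apply: IX; apply/card_leTP; exists f => i j fij.
  apply: contrapT => ij; apply: lv.
  have [_ /(_ ij)] := Cd i j _ _ (fP i) (fP j).
  by rewrite fij mdistxx subr0 ger0_norm.
have [f finj] := finite_card_lt_inj X_finite IX.
have [x0 _] := X_nonempty.
have f_pinv i : exists x, (exists2 y, f y = i & y = x) \/
    ((forall y, f y <> i) /\ x = x0).
  have [[y <-]|no] := pselect (exists y, f y = i).
    by exists y; left; exists y.
  by exists x0; right; split => // y fy; apply: no; exists y.
have /choice[s sP] := f_pinv.
exists (fun i x => s i = x); split.
- by move=> i; exists (s i).
- move=> x; exists (f x); case: (sP (f x)) => [[y /finj -> //]|[]].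
  by move=> /(_ x).
- move=> i j _ _ <- <-; split=> [->|_].
    by rewrite mdistxx; apply: le_trans l0 lv.
  have := mdist_ge0 (s i) (s j); have := dist_le_diam X_finite (s i) (s j).
  by rewrite ler_norml => ? ?; apply/andP; split; lra.
Qed.

Lemma simplex_close_feasible n l v : (0 < n)%N -> 0 <= l ->
  [set: 'I_n] #<= [set: X] ->
  simplex_close X 'I_n l v <-> D - l <= v /\ feasible (AD X n) l v.
Proof.
move=> n0 l0 /card_leTP[f finj]; split=> [close|[Dlv [_ [P PP <-] /= [p1 p2]]]].
- split; first exact: simplex_close_diam close.
  have [C [Cl Cr Cd]] := close.
  suff [P PP [P1 P2]] : exists2 P : 'I_n -> set X, partitions P &
      (forall i j x y, i <> j -> P i x -> P j y -> l - v <= mdist x y) /\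
      (forall i x y, P i x -> P i y -> mdist x y <= v).
    exists (alpha P, diam_partition P); first by exists P.
    by split; [apply/alpha_geP|apply/diam_partition_leP].
  (* For [v < l] the sets [C i] already form a partition: a common point of two of them would give
     [l <= v]. *)
  have [lv|vl] := leP l v; last first.
    exists C; last first.
      split=> [i j x y ij Cix Cjy|i x y Cix Ciy].
        have [_ /(_ ij)] := Cd i j x y Cix Cjy.
        by rewrite ler_norml => /andP[? ?]; lra.
      by have [/(_ erefl)] := Cd i i x y Cix Ciy.
    split.
    + by apply/seteqP; split => // x _; have [i Cix] := Cr x; exists i.
    + move=> i j _ _ [x [Cix Cjx]]; apply: contrapT => ij.
      have [_ /(_ ij)] := Cd i j x x Cix Cjx.
      by rewrite mdistxx subr0 ger0_norm//; lra.
    + by move=> i _; have [x Cix] := Cl i; exists x.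
  have /choice[t tP] := Cr.
  have [m [e [einj esurj]]] := finite_enum X_finite.
  have /choice[e' e'K] := esurj.
  have nm : (n <= #|'I_m|)%N.
    rewrite -[leqLHS]card_ord; apply: (@leq_card _ _ (e' \o f)) => i j /= ij.
    by apply: finj; rewrite -(e'K (f i)) -(e'K (f j)) ij.
  have [g gsurj gref] := surjective_refinement (fun k => t (e k)) nm.
  exists (fun i => [set x | g (e' x) = i]); last first.
    split=> [i j x y _ _ _|i x y /= <- gxy].
      by apply: le_trans (mdist_ge0 x y); lra.
    have := gref _ _ gxy; rewrite !e'K => txy.
    by have [/(_ (esym txy)) + _] := Cd _ _ x y (tP x) (tP y).
  split.
  + by apply/seteqP; split => // x _; exists (g (e' x)).
  + by move=> i j _ _ [x [/= <- <-]].
  + move=> i _; have [k gk] := gsurj i; exists (e k) => /=.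
    by rewrite -gk; congr g; apply: einj; rewrite e'K.
- exists P; split; [exact: (partitions_neq0 PP)|exact: (partitions_cover PP)|].
  move/(alpha_geP PP) : p1 => p1.
  move/(diam_partition_leP X_finite PP v n0) : p2 => p2.
  move=> i j x y Pix Pjy; split=> [ij|ij].
    by apply: (p2 i) => //; rewrite ij.
  have := p1 i j x y ij Pix Pjy; have := dist_le_diam X_finite x y.
  by rewrite ler_norml => ? ?; apply/andP; split; lra.
Qed.

(** Here [alpha] is [+oo], outside the analysis by levels, but the first branch of [M] applies. *)
Lemma M1 : M X 1 = Ext X 1.
Proof.
rewrite /M; case: asboolP => // -[] p [+ _].
rewrite AD1 // -(closure_id _).1; last exact: closed_finite_ereal_real.
by move=> ->; rewrite /Pi_plus /= addye// leey.
Qed.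

Lemma min_dist_gt0 : exists2 e : R, 0 < e &
  forall x y : X, x <> y -> e <= mdist x y.
Proof.
pose A := [set p : X * X | p.1 <> p.2].
have finA : finite_set A.
  apply: (@sub_finite_set _ _ ([set: X] `*` [set: X])) => //.
  exact: finite_setX.
have [A0|NA0] := pselect (A !=set0); last first.
  by exists 1 => // x y xy; case: NA0; exists (x, y).
have [p Ap pmin] := finite_argmin (fun p => mdist p.1 p.2) finA A0.
exists (mdist p.1 p.2); first by rewrite mdist_gt0; exact/eqP.
by move=> x y xy; exact: (pmin (x, y)).
Qed.

End Finite.

(** * Invariants recovered from the distances to simplexes *)

Section Indistinguishable.
Context (X Y : metricType R).
Hypotheses (X_nonempty : [set: X] !=set0) (Y_nonempty : [set: Y] !=set0).
Hypotheses (X_finite : finite_set [set: X]) (Y_finite : finite_set [set: Y]).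
Hypothesis XY : indistinguishable X Y.

Lemma indistinguishable_close I l v v' : [set: I] !=set0 -> 0 < l -> v < v' ->
  simplex_close X I l v -> simplex_close Y I l v'.
Proof.
move=> I0 l0 vv' close; have := XY I0 (ltW l0); rewrite !(simplexE _ l0) => E.
apply: (@dGH_simplex_close Y I (PosNum l0)); rewrite -E.
apply: le_lt_trans (simplex_close_dGH (lam := PosNum l0) X_nonempty close) _.
by rewrite lte_fin; lra.
Qed.

Lemma indistinguishable_diam_le : diam [set: Y] <= diam [set: X].
Proof.
apply/ler_addgt0Pr => e e0; apply/simplex_close_unit => //.
have := XY (ex_intro _ tt I : [set: unit] !=set0) (lexx 0).
rewrite !simplex0E => E; apply: (@dGH_simplex_close Y unit 1%:pos); rewrite -E.
have close : simplex_close X unit 1 (diam [set: X]) by apply/simplex_close_unit.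
apply: le_lt_trans (simplex_close_dGH (lam := 1%:pos) X_nonempty close) _.
by rewrite lte_fin; lra.
Qed.

Lemma indistinguishable_card_le : [set: X] #<= [set: Y].
Proof.
have [m [e [einj esurj]]] := finite_enum X_finite.
have [a a0 amin] := min_dist_gt0 X_finite.
have [x0 _] := X_nonempty; have [k0 _] := esurj x0.
(* With [a] the separation of [X] and [l = D + a], a bijection of the simplex with [X] has
   distortion at most [D], whereas a space with fewer points forces distortion at least [l]. *)
pose D := diam [set: X]; pose l := D + a.
have D0 : 0 <= D := le_trans (mdist_ge0 x0 x0) (dist_le_diam X_finite x0 x0).
have close : simplex_close X 'I_m l D.
  exists (fun k x => e k = x); split => //; first by move=> k; exists (e k).
  move=> i j _ _ <- <-; split=> [->|ij]; first by rewrite mdistxx.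
  have : e i <> e j by move=> /einj.
  move=> /amin; have := dist_le_diam X_finite (e i) (e j).
  by rewrite ler_norml -/D /l => ? ?; apply/andP; split; lra.
have l0 : 0 < l by rewrite /l; lra.
have Dl : D < D + a / 2 by lra.
have /choice[e' e'K] := esurj.
have XI : [set: X] #<= [set: 'I_m].
  by apply/card_leTP; exists e' => x y xy; rewrite -(e'K x) -(e'K y) xy.
apply: card_le_trans XI _; apply: contrapT => mY.
have := indistinguishable_close (ex_intro _ k0 I) l0 Dl close.
move=> /(simplex_close_large Y_finite Y_nonempty _ (ltW l0) mY)[].
by rewrite /l => ? _; lra.
Qed.

Lemma indistinguishable_feasible n l v v' : (0 < n)%N ->
  [set: 'I_n] #<= [set: X] -> [set: 'I_n] #<= [set: Y] -> 0 < l -> v < v' ->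
  diam [set: X] - l <= v -> feasible (AD X n) l v -> feasible (AD Y n) l v'.
Proof.
move=> n0 nX nY l0 vv' Dlv fX.
have close : simplex_close X 'I_n l v.
  by apply/simplex_close_feasible => //; exact: ltW.
have := indistinguishable_close (ex_intro _ (Ordinal n0) I) l0 vv' close.
by move=> /(simplex_close_feasible Y_finite Y_nonempty _ n0 (ltW l0) nY)[].
Qed.

End Indistinguishable.
End SimplexClose.

Theorem corollary7p9 (R : realType) (X Y : metricType R)
    (X_nonempty : [set: X] !=set0) (Y_nonempty : [set: Y] !=set0)
    (X_finite : finite_set [set: X]) (Y_finite : finite_set [set: Y]) :
  indistinguishable X Y <->
  [/\ [set: X] #= [set: Y],
      diam [set: X] = diam [set: Y] &
      forall n : nat, (1 <= n)%N -> [set: 'I_n] #<= [set: X] ->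
        M X n = M Y n].
Proof.
split=> [XY|[XYcard XYdiam XYM]].
- have YX : indistinguishable Y X by move=> I l I0 l0; rewrite XY.
  have XYcard : [set: X] #= [set: Y].
    rewrite card_eq_le; apply/andP; split.
      exact: indistinguishable_card_le X_finite Y_finite XY.
    exact: indistinguishable_card_le Y_finite X_finite YX.
  have XYdiam : diam [set: X] = diam [set: Y].
    by apply/le_anti; rewrite !indistinguishable_diam_le.
  (* For n = 1 the only pair is [(+oo, diam X)]; [M_sub_feasible] asks for finite first coordinates
     and serves n >= 2. *)
  split => // -[//|[_ _|n _ nX]].
    by rewrite !M1// /Ext !AD1// XYdiam.
  have nY : [set: 'I_n.+2] #<= [set: Y] by rewrite -(card_le_eqr XYcard).
  have XYf := indistinguishable_feasible X_nonempty Y_nonempty X_finite Y_finite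
    XY _ nX nY.
  have YXf := indistinguishable_feasible Y_nonempty X_nonempty Y_finite X_finite
    YX _ nY nX.
  apply/seteqP; split; apply: M_sub_feasible; try exact: AD_finite;
    try (by move=> q; exact: AD_fin_num); try (by move=> q; exact: AD_ge0);
    rewrite -?XYdiam// => l v v' l0 vv' Dlv.
  + exact: XYf.
  + by apply: YXf => //; rewrite -XYdiam.
  + by apply: YXf => //; rewrite -XYdiam.
  + exact: XYf.
- move=> I l I0; rewrite le_eqVlt => /orP[/eqP <-|l0].
    rewrite !simplex0E; apply/le_anti/andP.
    by split; apply: dGH_posSimplex_le => // v;
      rewrite !simplex_close_unit// XYdiam.
  rewrite !(simplexE _ l0).
  suff E v : simplex_close X I l v <-> simplex_close Y I l v.
    by apply/le_anti/andP; split; apply: dGH_posSimplex_le => // v /E.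
  (* For an index type larger than [X], only the diameter matters; otherwise the index type is
     finite and can be replaced by some ['I_n]. *)
  have [IX|IX] := pselect ([set: I] #<= [set: X]); last first.
    rewrite simplex_close_large//; last exact: ltW.
    rewrite simplex_close_large//; [by rewrite XYdiam|exact: ltW|].
    by rewrite -(card_le_eqr XYcard).
  have [n [e [einj esurj]]] := finite_enum (card_le_finite IX X_finite).
  have [i0 _] := I0; have [k0 _] := esurj i0.
  have n0 : (0 < n)%N by apply: leq_ltn_trans (ltn_ord k0).
  have nX : [set: 'I_n] #<= [set: X].
    by apply: card_le_trans IX; apply/card_leTP; exists e.
  have nY : [set: 'I_n] #<= [set: Y] by rewrite -(card_le_eqr XYcard).
  rewrite -!(simplex_close_bij _ _ _ einj esurj).
  rewrite (simplex_close_feasible X_finite X_nonempty v n0 (ltW l0) nX).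
  rewrite (simplex_close_feasible Y_finite Y_nonempty v n0 (ltW l0) nY) -XYdiam.
  (* The bound is kept as a premise because [feasible_M] passes between [AD] and [M] under it. *)
  suff E : diam [set: X] - l <= v ->
      feasible (AD X n) l v <-> feasible (AD Y n) l v.
    by split=> -[h1 /(E h1) h2].
  case: n {e einj esurj} k0 n0 nX nY => [//|[|n]] _ _ nX nY Dlv.
    by rewrite !AD1// XYdiam.
  rewrite -feasible_M ?XYM//; try exact: AD_finite; last first.
    by move=> q; exact: AD_fin_num.
  rewrite feasible_M -?XYdiam//; first exact: AD_finite.
  by move=> q; exact: AD_fin_num.
Qed.
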